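(* Assume the expert is allowed to make a prediction at every period, and let $\Xi(T)$ denote the a priori expected total reward (averaged over all signal realizations) of an expert who follows the optimal strategy, namely predicting truthfully at every period $T,T-1,\dots,1$. Then $$\Xi(T)=\frac12\sum_{t=1}^T\log\frac{t}{t-q}=\frac12\log\frac{\Gamma(1-q)\,\Gamma(T+1)}{\Gamma(T+1-q)},$$ so $\Xi(T)=O(\log T)$, and more precisely $$\lim_{T\to\infty}\frac{\Xi(T)}{q\log T+\log\Gamma(1-q)}=\frac12.$$
   Context: Model. Fix a quality parameter $q\in(0,1)$. Time is discrete and runs backwards $T,\dots,1,0$. Let $X_0$ be the outcome, and let $A_1,\dots,A_T,B_1,\dots,B_T$ be mutually independent random variables, independent of $X_0$, with $A_\tau\sim N(0,q)$ and $B_\tau\sim N(0,1-q)$. The market signal at time $t$ is $X_t=X_0+\sum_{\tau=1}^t(A_\tau+B_\tau)$ and the expert's private signal is $Y_t=X_0+\sum_{\tau=1}^t B_\tau$; lowercase $x_t,y_t$ denote realized values. The prior on $X_0$ is $N(0,\sigma_0^2)$ in the limit $\sigma_0^2\to\infty$ (a flat prior), so that posteriors of $X_0$ are determined by observed signals alone. At each time $t$, $x_t$ becomes common knowledge while $y_t$ is known only to the expert. A truthful prediction at time $t$ announces $y_t$, implicitly declaring the distribution $N(y_t,(1-q)t)$; the market is Bayesian and treats announcements as truthful. If the market's density for $X_0$ immediately before a prediction at time $t$ is $f_-$ and immediately after is $f_+$, the reward for that prediction is $W_t=\log(f_+(x_0)/f_-(x_0))$; the expert's total reward is the sum over all his predictions.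 $\Gamma$ is the Euler Gamma function. *)

(* Defs.v *)
From HB Require Import structures.
From mathcomp Require Import all_boot all_order all_algebra.
From mathcomp Require Import all_classical all_reals all_analysis.
Set Implicit Arguments. Unset Strict Implicit. Unset Printing Implicit Defensive.
Import Order.TTheory GRing.Theory Num.Theory numFieldNormedType.Exports.
Local Open Scope classical_set_scope.
Local Open Scope ring_scope.

Definition intR {R : realType} (f : R -> R) : R :=
  Rintegral (@lebesgue_measure R) setT f.

Definition Gamma {R : realType} (s : R) : R :=
  Rintegral (@lebesgue_measure R) `]0, +oo[ (fun t => t `^ (s - 1) * expR (- t)).

Definition gpdf {R : realType} (v u : R) : R := normal_pdf 0 (Num.sqrt v) u.

(* A realization of the signals is a pair of sequences x, y : nat -> R with
   x t = x_t, y t = y_t for 1 <= t <= T; index 0 is the outcome x_0. *)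
Definition upd {R : realType} (f : nat -> R) (i : nat) (u : R) : nat -> R :=
  fun n => if n == i then u else f n.

Definition at0 {R : realType} (x0 : R) (f : nat -> R) : nat -> R :=
  fun n => if n == 0%N then x0 else f n.

(* Joint density of (X_1..X_T, Y_1..Y_T) given X_0 = x0:  the increments
   Y_k - Y_(k-1) = B_k ~ N(0,1-q) and (X_k - Y_k) - (X_(k-1) - Y_(k-1)) = A_k
   ~ N(0,q) are independent, and the map (A,B) -> (X,Y) has Jacobian 1. *)
Definition joint {R : realType} (q : R) (T : nat) (x0 : R)
    (x y : nat -> R) : R :=
  let X := at0 x0 x in let Y := at0 x0 y in
  \prod_(1 <= k < T.+1)
     (gpdf (1 - q) (Y k - Y k.-1) *
      gpdf q ((X k - Y k) - (X k.-1 - Y k.-1))).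

Definition intX {R : realType} (l : seq nat)
    (F : (nat -> R) -> (nat -> R) -> R) : (nat -> R) -> (nat -> R) -> R :=
  foldr (fun i G => fun x y => intR (fun u => G (upd x i u) y)) F l.
Definition intY {R : realType} (l : seq nat)
    (F : (nat -> R) -> (nat -> R) -> R) : (nat -> R) -> (nat -> R) -> R :=
  foldr (fun i G => fun x y => intR (fun u => G x (upd y i u))) F l.

(* Likelihood of X_0 = z given what the market knows immediately before the
   prediction at time t: x_T..x_t and the (truthful) announcements y_T..y_(t+1);
   unobserved x_1..x_(t-1) and y_1..y_t are integrated out. *)
Definition lik_before {R : realType} (q : R) (T t : nat) (x y : nat -> R)
    (z : R) : R :=
  intX (iota 1 t.-1) (intY (iota 1 t) (joint q T z)) x y.
(* ... and immediately after (y_t is now also known). *)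
Definition lik_after {R : realType} (q : R) (T t : nat) (x y : nat -> R)
    (z : R) : R :=
  intX (iota 1 t.-1) (intY (iota 1 t.-1) (joint q T z)) x y.

(* Posterior density under the flat prior: normalized likelihood. *)
Definition posterior {R : realType} (L : R -> R) (z : R) : R := L z / intR L.

Definition reward {R : realType} (q : R) (T t : nat) (x0 : R)
    (x y : nat -> R) : R :=
  ln (posterior (lik_after q T t x y) x0 / posterior (lik_before q T t x y) x0).

Definition total_reward {R : realType} (q : R) (T : nat) (x0 : R)
    (x y : nat -> R) : R :=
  \sum_(1 <= t < T.+1) reward q T t x0 x y.

Definition Xi {R : realType} (q : R) (T : nat) (x0 : R) : R :=
  intX (iota 1 T) (intY (iota 1 T)
    (fun x y => joint q T x0 x y * total_reward q T x0 x y))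
    (fun _ => 0) (fun _ => 0).

(* Main.v *)
(** Put [U_k = Y_k - (1 - q) X_k].  The increments [A + B] of [X] and
    [q B - (1 - q) A] of [U] are uncorrelated, so under the joint density [X]
    and [U] are independent Gaussian random walks with step variances [1] and
    [q (1 - q)], started at [x_0] and [q x_0].  By Chapman-Kolmogorov each
    likelihood is, up to a factor free of [x_0], a product of at most two
    Gaussian densities, and the rewards telescope to
    [\sum_t (ln g_(q (t - q)) (U_t - q X_(t-1)) - ln g_(q t) (U_t - q X_t))],
    where [g_v] is the density of [N(0, v)].  The arguments have variances
    [q (t - q)] and [q t], so the quadratic parts cancel in expectation and
    [1/2 ln (t / (t - q))] remains.  The Gamma form is the functional equation,
    and the asymptotics follow from [ln (1 + u) <= u] by telescoping. *)

Require Import Defs.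
From HB Require Import structures.
From mathcomp Require Import all_boot all_order all_algebra.
From mathcomp Require Import all_classical all_reals all_analysis.
From mathcomp Require Import measurable_realfun ring lra.
Import Order.TTheory GRing.Theory Num.Theory numFieldNormedType.Exports.
Local Open Scope classical_set_scope.
Local Open Scope ring_scope.

(* As [f] and [g] are nonnegative, monotone convergence gives the identity in
   the extended reals, without assuming integrability. *)
Lemma ge0_integral_FTC_exhaust {R : realType} (D : set R) (a b : nat -> R)
    (f g F : R -> R) (l : R) :
  (forall n, a n < b n) ->
  nonincreasing_seq a -> nondecreasing_seq b ->
  D = \bigcup_n `[a n, b n]%classic ->
  (forall x, D x -> 0 <= f x) -> (forall x, D x -> 0 <= g x) ->
  (forall x, D x -> {for x, continuous f}) ->
  (forall x, D x -> {for x, continuous g}) ->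
  (forall x, D x -> is_derive x 1 F (f x - g x)) ->
  F (b n) - F (a n) @[n --> \oo] --> l ->
  (\int[lebesgue_measure]_(x in D) (f x)%:E =
   \int[lebesgue_measure]_(x in D) (g x)%:E + l%:E)%E.
Proof.
move=> ab adec binc DE f0 g0 cf cg dF Fl.
have subD n : `[a n, b n] `<=` D by rewrite DE => x xn; exists n.
have cW (h : R -> R) n : (forall x, D x -> {for x, continuous h}) ->
    {within `[a n, b n], continuous h}.
  move=> ch; apply/subspace_continuousP => x xn.
  by apply: cvg_within_filter; exact/ch/(subD n).
have iW (h : R -> R) n : (forall x, D x -> {for x, continuous h}) ->
    lebesgue_measure.-integrable `[a n, b n] (EFin \o h).
  move=> ch; apply: continuous_compact_integrable; first exact: segment_compact.
  exact: cW.
have ndI : nondecreasing_seq (fun n => `[a n, b n]%classic).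
  move=> m n mn; rewrite subsetEset; apply: subset_itv; rewrite bnd_simp.
    exact: adec.
  exact: binc.
have cI (h : R -> R) : (forall x, D x -> 0 <= h x) ->
    (forall x, D x -> {for x, continuous h}) ->
    (\int[lebesgue_measure]_(x in `[a n, b n]) (h x)%:E @[n --> \oo] -->
     \int[lebesgue_measure]_(x in D) (h x)%:E)%E.
  move=> h0 ch; rewrite DE; apply: ge0_nondecreasing_set_cvg_integral => //.
    by move=> n; have /integrableP[] := iW h n ch.
  by move=> n x /subD; rewrite lee_fin; exact: h0.
have E n : (\int[lebesgue_measure]_(x in `[a n, b n]) (f x)%:E =
    \int[lebesgue_measure]_(x in `[a n, b n]) (g x)%:E + (F (b n) - F (a n))%:E)%E.
  have dFn x : x \in `[a n, b n] -> derivable F x 1.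
    by move=> xn; have [] := dF x (subD n x xn).
  have : (\int[lebesgue_measure]_(x in `[a n, b n]) (f x - g x)%:E =
      (F (b n))%:E - (F (a n))%:E)%E.
    apply: continuous_FTC2 => //.
    - apply: within_continuousB; exact: cW.
    - have /continuous_within_itvP : {within `[a n, b n], continuous F}.
        exact: derivable_within_continuous.
      move=> /(_ (ab n))[_ ? ?]; split => // x xn.
      by apply: dFn; exact: subset_itv_oo_cc xn.
    - move=> x xn; rewrite derive1E; have [|_ //] := dF x _.
      by apply: (subD n); exact: subset_itv_oo_cc xn.
  under eq_integral do rewrite EFinB.
  rewrite integralB//; [|exact: iW..].
  rewrite EFinB => <-; rewrite addeC subeK//.
  by apply: integrable_fin_num => //; exact: iW.
have := cI _ f0 cf; under eq_fun do rewrite E.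
move=> cf'; apply/esym/(cvg_unique _ _ cf') => //.
apply: cvgeD; last 2 first.
- exact: cI.
- by apply: cvg_EFin => //; exact: nearW.
by rewrite fin_num_adde_defl.
Qed.

(** * Gaussian moments *)

Lemma gpdfE {R : realType} (v u : R) : 0 < v ->
  gpdf v u = (Num.sqrt (v * pi *+ 2))^-1 * expR (- u ^+ 2 / (v *+ 2)).
Proof.
move=> v0; rewrite /gpdf normal_pdfE ?gt_eqF ?sqrtr_gt0//.
by rewrite /normal_peak /normal_fun sqr_sqrtr ?subr0// ltW.
Qed.

Lemma gpdf_gt0 {R : realType} (v u : R) : 0 < v -> 0 < gpdf v u.
Proof.
move=> v0; rewrite gpdfE// mulr_gt0 ?expR_gt0// invr_gt0 sqrtr_gt0.
by rewrite pmulrn_lgt0// mulr_gt0 ?pi_gt0.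
Qed.

Lemma gpdfN {R : realType} (v u : R) : 0 < v -> gpdf v (- u) = gpdf v u.
Proof. by move=> v0; rewrite !gpdfE// sqrrN. Qed.

Lemma is_derive_gpdf {R : realType} (v m x : R) : 0 < v ->
  is_derive x 1 (fun u => gpdf v (u - m)) (- ((x - m) / v) * gpdf v (x - m)).
Proof.
move=> v0.
have -> : (fun u => gpdf v (u - m)) =
    (Num.sqrt (v * pi *+ 2))^-1 \*:
      (expR \o (fun u : R => (- (v *+ 2)^-1) * (u - m) ^+ 2) : R -> R^o).
  apply/funext => u; rewrite gpdfE// /GRing.scale/=.
  by congr (_ * expR _); ring.
have dsq : is_derive x 1 (fun u : R => (- (v *+ 2)^-1) * (u - m) ^+ 2)
    (- ((x - m) / v)).
  apply: (is_derive_eq (f := fun u : R => (- (v *+ 2)^-1) * (u - m) ^+ 2)).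
  rewrite /GRing.scale/=; field; rewrite ?gt_eqF//.
have dE : is_derive x 1 (expR \o (fun u : R => (- (v *+ 2)^-1) * (u - m) ^+ 2))
    (expR (- (v *+ 2)^-1 * (x - m) ^+ 2) * - ((x - m) / v)).
  exact: is_derive1_comp.
have dZ := @is_deriveZ R R^o R^o _ (Num.sqrt (v * pi *+ 2))^-1 x 1 _ dE.
apply: is_derive_eq dZ _.
rewrite gpdfE// /GRing.scale/=.
rewrite [in LHS](_ : - (v *+ 2)^-1 * (x - m) ^+ 2 = - (x - m) ^+ 2 / (v *+ 2)); last ring.
by ring.
Qed.

Lemma continuous_gpdf {R : realType} (v m : R) : 0 < v ->
  continuous (fun u => gpdf v (u - m)).
Proof.
move=> v0 x; apply/differentiable_continuous/derivable1_diffP.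
by have [] := is_derive_gpdf v m x v0.
Qed.

(** Since [expR w >= 1 + w] at [w = n^2 / 2v], the product is [O(1/n)]. It is the boundary term in
    the second moment. *)
Lemma cvg_natM_gpdf {R : realType} (v : R) : 0 < v ->
  n.+1%:R * gpdf v n.+1%:R @[n --> \oo] --> (0 : R).
Proof.
move=> v0; pose k := (Num.sqrt (v * pi *+ 2))^-1.
have k0 : 0 <= k by rewrite invr_ge0 sqrtr_ge0.
apply: (@squeeze_cvgr _ _ _ _ (fun=> 0) (fun n => k * v *+ 2 * n.+1%:R^-1)).
- apply: nearW => n; apply/andP; split.
    by rewrite mulr_ge0// ltW// gpdf_gt0.
  have n0 : 0 < n.+1%:R :> R by rewrite ltr0n.
  rewrite gpdfE// -/k mulrCA -mulrnAr -mulrA ler_wpM2l//.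
  rewrite mulNr expRN -[leRHS]mulr1 -[X in _ <= _ * X](@mulfV _ n.+1%:R) ?gt_eqF//.
  rewrite ler_pdivrMr ?expR_gt0//.
  apply: (@le_trans _ _ ((v *+ 2) / n.+1%:R * (n.+1%:R / n.+1%:R) * (n.+1%:R ^+ 2 / (v *+ 2)))).
    by rewrite le_eqVlt; apply/orP; left; apply/eqP; field; rewrite !gt_eqF.
  rewrite ler_wpM2l//.
    by rewrite mulfV ?gt_eqF// mulr1 divr_ge0 ?mulrn_wge0// ltW.
  by rewrite (le_trans _ (expR_ge1Dx _))// lerDr.
- exact: cvg_cst.
- rewrite -[X in _ --> X](mulr0 (k * v *+ 2)); apply: cvgM; first exact: cvg_cst.
  exact: cvg_harmonic.
Qed.

Lemma bigcup_itv_center {R : realType} (m : R) :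
  [set: R] = \bigcup_n `[m - n.+1%:R, m + n.+1%:R]%classic.
Proof.
apply/seteqP; split => // x _.
exists (Num.trunc `|x - m|) => //=; rewrite in_itv/=.
have := truncnS_gt `|x - m|.
by rewrite ltr_norml => /andP[]; lra.
Qed.

Lemma integral_gpdf {R : realType} (v m : R) : 0 < v ->
  (\int[lebesgue_measure]_u (gpdf v (u - m))%:E = 1)%E.
Proof.
move=> v0; rewrite -(integral_normal_pdf m (Num.sqrt v)).
apply: eq_integral => u _; rewrite /gpdf !normal_pdfE ?gt_eqF ?sqrtr_gt0//.
by rewrite /normal_fun subr0.
Qed.

(** Integration by parts: the derivative of [- v (u - m) g] is [(u - m)^2 g - v g], where [g] is the
    density. *)
Lemma integral_sqr_gpdf {R : realType} (v m : R) : 0 < v ->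
  (\int[lebesgue_measure]_u ((u - m) ^+ 2 * gpdf v (u - m))%:E = v%:E)%E.
Proof.
move=> v0; have g0 u := gpdf_gt0 v u v0.
have cu : continuous (fun u : R => u - m).
  by move=> x; apply: cvgB; [exact: cvg_id|exact: cvg_cst].
etransitivity.
  apply: (@ge0_integral_FTC_exhaust _ _ (fun n => m - n.+1%:R)
  (fun n => m + n.+1%:R) _ (fun u => v * gpdf v (u - m))
  (fun u => - v * ((u - m) * gpdf v (u - m))) 0).
  - by move=> n; rewrite ltrD2l gtrN// ltr0n.
  - by move=> a b ab; rewrite lerD2l lerN2 ler_nat.
  - by move=> a b ab; rewrite lerD2l ler_nat.
  - exact: bigcup_itv_center.
  - by move=> u _; rewrite mulr_ge0 ?sqr_ge0// ltW.
  - by move=> u _; rewrite mulr_ge0// ltW.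
  - move=> u _; apply: cvgM; last exact: continuous_gpdf.
    by apply: cvgM; exact: cu.
  - move=> u _; apply: cvgM; last exact: continuous_gpdf.
    exact: cvg_cst.
  - move=> u _; have := is_derive_gpdf v m u v0 => d.
    apply: is_derive_eq; rewrite /GRing.scale/=; field.
    by rewrite gt_eqF.
  - have h : - (v *+ 2) * (n.+1%:R * gpdf v n.+1%:R) @[n --> \oo] --> (0 : R).
      rewrite -[X in _ --> X](mulr0 (- (v *+ 2))); apply: cvgM; first exact: cvg_cst.
      exact: cvg_natM_gpdf.
    apply: cvg_trans h; apply: near_eq_cvg; apply: nearW => n.
    have -> : m + n.+1%:R - m = n.+1%:R by ring.
    have -> : m - n.+1%:R - m = - n.+1%:R by ring.
    rewrite gpdfN//; ring.
rewrite adde0; under eq_integral do rewrite EFinM.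
rewrite ge0_integralZl_EFin ?ltW//.
+ by rewrite integral_gpdf// mule1.
+ by move=> u _; rewrite lee_fin ltW.
+ apply/measurable_EFinP; apply: continuous_measurable_fun.
  exact: continuous_gpdf.
Qed.

Lemma integrable_sqr_gpdf {R : realType} (v m : R) : 0 < v ->
  lebesgue_measure.-integrable [set: R]
    (EFin \o (fun u => (u - m) ^+ 2 * gpdf v (u - m))).
Proof.
move=> v0; apply/integrableP; split.
  apply/measurable_EFinP; apply: continuous_measurable_fun => u.
  apply: cvgM; last exact: continuous_gpdf.
  by apply: cvgM; apply: cvgB; [exact: cvg_id|exact: cvg_cst|exact: cvg_id|exact: cvg_cst].
under eq_integral.
  move=> u _; rewrite gee0_abs ?lee_fin; last first.
    by rewrite mulr_ge0 ?sqr_ge0// ltW// gpdf_gt0.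
  over.
by rewrite integral_sqr_gpdf// ltry.
Qed.

Lemma integrable_gpdf {R : realType} (v m : R) : 0 < v ->
  lebesgue_measure.-integrable [set: R] (EFin \o (fun u => gpdf v (u - m))).
Proof.
move=> v0; apply/integrableP; split.
  by apply/measurable_EFinP; apply: continuous_measurable_fun; exact: continuous_gpdf.
under eq_integral.
  move=> u _; rewrite gee0_abs ?lee_fin; last by rewrite ltW// gpdf_gt0.
  over.
by rewrite integral_gpdf// ltry.
Qed.

(* Yields the first moment, whose own integrand changes sign. *)
Lemma integral_sqrD1_gpdf {R : realType} (v m : R) : 0 < v ->
  (\int[lebesgue_measure]_u ((u - m + 1) ^+ 2 * gpdf v (u - m))%:E =
   (v + 1)%:E)%E.
Proof.
move=> v0; have g0 u := gpdf_gt0 v u v0.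
have cu : continuous (fun u : R => u - m).
  by move=> x; apply: cvgB; [exact: cvg_id|exact: cvg_cst].
have cu1 : continuous (fun u : R => u - m + 1).
  move=> x; apply: cvgD; last exact: cvg_cst.
  by apply: cvgB; [exact: cvg_id|exact: cvg_cst].
etransitivity.
  apply: (@ge0_integral_FTC_exhaust _ _ (fun n => m - n.+1%:R)
  (fun n => m + n.+1%:R) _
  (fun u => (u - m) ^+ 2 * gpdf v (u - m) + gpdf v (u - m))
  (fun u => - (v *+ 2) * gpdf v (u - m)) 0).
  - by move=> n; rewrite ltrD2l gtrN// ltr0n.
  - by move=> a b ab; rewrite lerD2l lerN2 ler_nat.
  - by move=> a b ab; rewrite lerD2l ler_nat.
  - exact: bigcup_itv_center.
  - by move=> u _; rewrite mulr_ge0 ?sqr_ge0// ltW.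
  - by move=> u _; apply: addr_ge0; [apply: mulr_ge0; [exact: sqr_ge0|exact/ltW]|exact/ltW].
  - move=> u _; apply: cvgM; last exact: continuous_gpdf.
    by apply: cvgM; exact: cu1.
  - move=> u _; apply: cvgD; last exact: continuous_gpdf.
    apply: cvgM; last exact: continuous_gpdf.
    by apply: cvgM; exact: cu.
  - move=> u _; have := is_derive_gpdf v m u v0 => d.
    apply: is_derive_eq; rewrite /GRing.scale/=; field.
    by rewrite gt_eqF.
  (* The integrands differ by [2 (u - m) g], the derivative of [- 2 v g]. As [g] is even, the
     boundary term is zero for every [n]. *)
  - have h : (fun _ : nat => 0) @ \oo --> (0 : R) by exact: cvg_cst.
    apply: cvg_trans h; apply: near_eq_cvg; apply: nearW => n.
    have -> : m + n.+1%:R - m = n.+1%:R by ring.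
    have -> : m - n.+1%:R - m = - n.+1%:R by ring.
    by rewrite gpdfN// subrr.
rewrite adde0; under eq_integral do rewrite EFinD.
rewrite integralD//=; [|exact: integrable_sqr_gpdf|exact: integrable_gpdf].
by rewrite integral_sqr_gpdf// integral_gpdf.
Qed.

Lemma intR_gpdf_quadratic {R : realType} (v m a b c : R) : 0 < v ->
  intR (fun u => gpdf v (u - m) * (a + b * u + c * u ^+ 2)) =
  a + b * m + c * (m ^+ 2 + v).
Proof.
move=> v0.
have i0 := integrable_gpdf v m v0.
have i2 := integrable_sqr_gpdf v m v0.
have cu1 : continuous (fun u : R => u - m + 1).
  move=> x; apply: cvgD; last exact: cvg_cst.
  by apply: cvgB; [exact: cvg_id|exact: cvg_cst].
have i1 : lebesgue_measure.-integrable [set: R]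
    (EFin \o (fun u => (u - m + 1) ^+ 2 * gpdf v (u - m))).
  apply/integrableP; split.
    apply/measurable_EFinP; apply: continuous_measurable_fun => u.
    apply: cvgM; last exact: continuous_gpdf.
    by apply: cvgM; exact: cu1.
  under eq_integral.
    move=> u _; rewrite gee0_abs ?lee_fin; last first.
      by rewrite mulr_ge0 ?sqr_ge0// ltW// gpdf_gt0.
    over.
  by rewrite integral_sqrD1_gpdf// ltry.
(* In powers of [u - m] the linear coefficient is [b + 2 c m]. Only [(u - m + 1)^2] supplies a
   linear term, namely [2 (u - m)], hence the halving. *)
pose be := (b + c * m *+ 2) / 2.
transitivity (intR (fun u => be * ((u - m + 1) ^+ 2 * gpdf v (u - m)) +
  ((c - be) * ((u - m) ^+ 2 * gpdf v (u - m)) +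
   (a + b * m + c * m ^+ 2 - be) * gpdf v (u - m)))).
  by congr intR; apply/funext => u; rewrite /be; field.
rewrite /intR RintegralD//=; last 2 first.
- exact: (integrableZl _ be i1).
- apply: (integrableD _ (integrableZl _ _ i2) (integrableZl _ _ i0)) => //.
rewrite RintegralD//=; last 2 first.
- exact: (integrableZl _ _ i2).
- exact: (integrableZl _ _ i0).
rewrite !RintegralZl// /Rintegral integral_sqrD1_gpdf// integral_sqr_gpdf//.
by rewrite integral_gpdf//= /be; field.
Qed.

(** * The Gamma function *)

(** Keeping the value in the extended reals lets the functional equation precede any proof of
    convergence. *)
Definition Gammae {R : realType} (s : R) : \bar R :=
  (\int[lebesgue_measure]_(t in `]0%R, +oo[) (t `^ (s - 1) * expR (- t))%:E)%E.

Lemma bigcup_itv0y {R : realType} :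
  `]0, +oo[%classic = \bigcup_n `[n.+2%:R^-1, n.+2%:R : R]%classic.
Proof.
apply/seteqP; split => x /=; rewrite in_itv/= andbT; last first.
  by move=> [n _ /=]; rewrite in_itv/= => /andP[+ _]; apply: lt_le_trans.
move=> x0; exists (maxn (Num.trunc x) (Num.trunc x^-1)) => //=.
rewrite in_itv/=; apply/andP; split.
  rewrite invf_ple ?posrE ?ltr0n//.
  rewrite (le_trans (ltW (truncnS_gt _)))// ler_nat.
  by rewrite -addn2 -addn1 leq_add ?leq_maxr.
rewrite (le_trans (ltW (truncnS_gt _)))// ler_nat.
by rewrite -addn2 -addn1 leq_add ?leq_maxl.
Qed.

Lemma continuous_Gamma_integrand {R : realType} (s t : R) : 0 < t ->
  {for t, continuous (fun t => t `^ s * expR (- t))}.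
Proof.
move=> t0; have cp : {for t, continuous (fun t => t `^ s)}.
  apply/differentiable_continuous/derivable1_diffP.
  by have [] := is_derive1_powR s t0.
apply: cvgM; first exact: cp.
apply: (cvg_comp (fun t : R => - t) expR); last exact: continuous_expR.
by apply: cvgN; exact: cvg_id.
Qed.

Lemma cvg_powR_expRN {R : realType} (s : R) :
  n.+2%:R `^ s * expR (- n.+2%:R) @[n --> \oo] --> (0 : R).
Proof.
(* As [k > |s|], the bound [expR t >= t^(k+1) / (k+1)!] leaves at most [(k+1)! / t]. *)
pose k := (Num.trunc `|s|).+1.
apply: (@squeeze_cvgr _ _ _ _ (fun=> 0) (fun n => (k.+1)`!%:R * n.+2%:R^-1)).
- apply: nearW => n; rewrite mulr_ge0 ?powR_ge0 ?expR_ge0//=.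
  have n0 : 0 < n.+2%:R :> R by rewrite ltr0n.
  rewrite expRN ler_pdivrMr ?expR_gt0// mulrAC ler_pdivlMr//.
  rewrite (@le_trans _ _ (n.+2%:R ^+ k * n.+2%:R))//.
    rewrite ler_pM2r// -powR_mulrn// ler_powR ?ler1n//.
    by rewrite (le_trans (ler_norm _))// ltW// truncnS_gt.
  rewrite -exprSr -ler_pdivrMl ?ltr0n ?fact_gt0// mulrC.
  by rewrite (le_trans _ (expR_ge1Dxn k (ltW n0)))// lerDr.
- exact: cvg_cst.
- rewrite -[X in _ --> X](mulr0 (k.+1)`!%:R); apply: cvgM; first exact: cvg_cst.
  by have := @cvg_harmonic R; rewrite -(cvg_shiftS (@harmonic R)).
Qed.

Lemma nondecreasing_natS2 {R : realType} :
  nondecreasing_seq (fun n => n.+2%:R : R).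
Proof. by move=> a b ab; rewrite ler_nat. Qed.

Lemma nonincreasing_invS2 {R : realType} :
  nonincreasing_seq (fun n => n.+2%:R^-1 : R).
Proof. by move=> a b ab; rewrite lef_pV2 ?posrE ?ltr0n// ler_nat. Qed.

Lemma invS2_lt {R : realType} n : n.+2%:R^-1 < n.+2%:R :> R.
Proof. by rewrite (@lt_trans _ _ 1)// ?invf_lt1 ?ltr0n// ltr1n. Qed.

Lemma is_derive_expRN {R : realType} (t : R) :
  is_derive t 1 (fun t => expR (- t)) (- expR (- t)).
Proof.
have d : is_derive t 1 (expR \o (fun t : R => - t)) (expR (- t) * -1).
  exact: is_derive1_comp.
by apply: (is_derive_eq d); rewrite mulrN1.
Qed.

(** Integration by parts with primitive [t^s expR (- t)], which also serves as the second integrand.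
    The hypothesis [0 < s] makes it vanish at the lower end. *)
Lemma GammaeD1 {R : realType} (s : R) : 0 < s -> (Gammae (s + 1) = s%:E * Gammae s)%E.
Proof.
move=> s0; have m0 : measurable_fun (`]0%R, +oo[%classic : set R)
    (fun t : R => t `^ (s - 1) * expR (- t)).
  apply: open_continuous_measurable_fun => // t.
  by rewrite inE/= in_itv/= andbT => t0; exact: continuous_Gamma_integrand.
rewrite /Gammae addrK -ge0_integralZl_EFin ?(ltW s0)//; last 2 first.
- by move=> t _; rewrite lee_fin mulr_ge0 ?powR_ge0 ?expR_ge0.
- exact/measurable_EFinP.
under [RHS]eq_integral do rewrite -EFinM.
apply/esym.
etransitivity.
  apply: (@ge0_integral_FTC_exhaust _ _ (fun n => n.+2%:R^-1) (fun n => n.+2%:R)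
  _ (fun t => t `^ s * expR (- t)) (fun t => t `^ s * expR (- t)) 0).
  - exact: invS2_lt.
  - exact: nonincreasing_invS2.
  - exact: nondecreasing_natS2.
  - exact: bigcup_itv0y.
  - by move=> t _; rewrite /= mulr_ge0 ?(ltW s0)// mulr_ge0 ?powR_ge0 ?expR_ge0.
  - by move=> t _; rewrite mulr_ge0 ?powR_ge0 ?expR_ge0.
  - move=> t; rewrite /= in_itv/= andbT => t0.
    apply: cvgM; first exact: cvg_cst.
    exact: continuous_Gamma_integrand.
  - by move=> t; rewrite /= in_itv/= andbT => t0; exact: continuous_Gamma_integrand.
  - move=> t; rewrite /= in_itv/= andbT => t0.
    have dp := is_derive1_powR s t0.
    have de := is_derive_expRN t.
    apply: is_derive_eq; rewrite /GRing.scale/=; ring.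
  - rewrite -[X in _ --> X](subrr 0); apply: cvgB; first exact: cvg_powR_expRN.
    rewrite -[X in _ --> X](mul0r 1); apply: cvgM; last first.
      rewrite -[X in _ --> X](@expR0 R) -oppr0.
      apply: (cvg_comp (fun n : nat => - n.+2%:R^-1) expR); last exact: continuous_expR.
      apply: cvgN.
      by have := @cvg_harmonic R; rewrite -(cvg_shiftS (@harmonic R)).
    have /cvg_at_rightP h := powR_cvg0 s0.
    apply: h; split => //.
    by have := @cvg_harmonic R; rewrite -(cvg_shiftS (@harmonic R)).
by rewrite adde0.
Qed.

Lemma Gammae1 {R : realType} : Gammae (1 : R) = 1%E.
Proof.
rewrite /Gammae subrr.
etransitivity.
  apply: (@ge0_integral_FTC_exhaust _ _ (fun n => n.+2%:R^-1) (fun n => n.+2%:R)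
  _ (fun t => 0) (fun t => - expR (- t)) 1).
  - exact: invS2_lt.
  - exact: nonincreasing_invS2.
  - exact: nondecreasing_natS2.
  - exact: bigcup_itv0y.
  - by move=> t _; rewrite mulr_ge0 ?powR_ge0 ?expR_ge0.
  - by [].
  - move=> t; rewrite /= in_itv/= andbT => t0.
    exact: continuous_Gamma_integrand.
  - by move=> t _; exact: cvg_cst.
  - move=> t _; have de := is_derive_expRN t.
    by apply: is_derive_eq; rewrite powRr0 mul1r opprK subr0.
  - have h : - (n.+2%:R `^ 0 * expR (- n.+2%:R)) + expR (- n.+2%:R^-1)
        @[n --> \oo] --> (1 : R).
      rewrite -[X in _ --> X]add0r -[X in _ --> X + _]oppr0; apply: cvgD.
        by apply: cvgN; exact: cvg_powR_expRN.
      rewrite -[X in _ --> X](@expR0 R) -oppr0.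
      apply: (cvg_comp (fun n : nat => - n.+2%:R^-1) expR); last exact: continuous_expR.
      apply: cvgN.
      by have := @cvg_harmonic R; rewrite -(cvg_shiftS (@harmonic R)).
    apply: cvg_trans h; apply: near_eq_cvg; apply: nearW => n.
    by rewrite opprK powRr0 mul1r.
by rewrite integral0 add0e.
Qed.

Lemma measurable_Gamma_integrand {R : realType} (s : R) :
  measurable_fun (`]0%R, +oo[%classic : set R)
    (fun t : R => (t `^ s * expR (- t))%:E).
Proof.
apply/measurable_EFinP.
apply: open_continuous_measurable_fun => // t.
by rewrite inE/= in_itv/= andbT => t0; exact: continuous_Gamma_integrand.
Qed.

(** On this range [t^(s-1) <= 1 + t], so the integral is dominated by those at [1] and [2], both
    equal to [1]. *)
Lemma Gammae_lty {R : realType} (s : R) : 1 <= s <= 2 -> (Gammae s < +oo)%E.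
Proof.
move=> /andP[s1 s2].
have G2 : Gammae (2 : R) = 1%E.
  by rewrite (_ : 2 = 1 + 1 :> R)// GammaeD1// Gammae1 mule1.
apply: (@le_lt_trans _ _ (Gammae 1 + Gammae 2)%E); last first.
  by rewrite Gammae1 G2 -EFinD ltry.
rewrite /Gammae -ge0_integralD//; last 4 first.
- by move=> t _; rewrite lee_fin mulr_ge0 ?powR_ge0 ?expR_ge0.
- exact: measurable_Gamma_integrand.
- by move=> t _; rewrite lee_fin mulr_ge0 ?powR_ge0 ?expR_ge0.
- exact: measurable_Gamma_integrand.
apply: ge0_le_integral => //=.
- by move=> t _; rewrite lee_fin mulr_ge0 ?powR_ge0 ?expR_ge0.
- exact: measurable_Gamma_integrand.
- by apply: emeasurable_funD; exact: measurable_Gamma_integrand.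
- move=> t; rewrite in_itv/= andbT => t0; rewrite -EFinD lee_fin -mulrDl.
  rewrite ler_wpM2r ?expR_ge0// subrr powRr0.
  have [t1|t1] := leP t 1.
    rewrite (@le_trans _ _ 1)// ?lerDl ?powR_ge0//.
    have := @ger_powR R t _ 0 (s - 1); rewrite t0 t1 powRr0; apply => //; lra.
  rewrite (@le_trans _ _ (t `^ (2 - 1)))// ?lerDr//.
  by rewrite ler_powR ?(ltW t1)//; lra.
Qed.

(** On [[1, 2]] the integrand is at least [expR (-2)]. *)
Lemma Gammae_gt0 {R : realType} (s : R) : 1 <= s -> (0 < Gammae s)%E.
Proof.
move=> s1; have sub : `[1, 2]%classic `<=` (`]0%R, +oo[%classic : set R).
  by move=> t /=; rewrite !in_itv/= andbT => /andP[t1 _]; lra.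
apply: (@lt_le_trans _ _ (expR (-2) : R)%:E); first by rewrite lte_fin expR_gt0.
apply: (@le_trans _ _
  (\int[lebesgue_measure]_(t in `[1%R, 2%R]) (t `^ (s - 1) * expR (- t))%:E)%E);
  last first.
  apply: ge0_subset_integral => //=.
  - exact: measurable_Gamma_integrand.
  - by move=> t _; rewrite lee_fin mulr_ge0 ?powR_ge0 ?expR_ge0.
apply: (@le_trans _ _
  (\int[lebesgue_measure]_(t in `[1%R, 2%R]) (cst (expR (-2) : R)%:E t))%E).
  rewrite integral_cst//= lebesgue_measure_itv/= lte_fin ltr1n.
  by rewrite -EFinD (_ : 2 - 1 = 1 :> R) ?mule1//; lra.
apply: ge0_le_integral => //=.
- apply: measurable_funS sub _ => //; exact: measurable_Gamma_integrand.
- move=> t; rewrite in_itv/= => /andP[t1 t2]; rewrite lee_fin.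
  rewrite -[leLHS]mul1r ler_pM ?expR_ge0//; last by rewrite ler_expR lerN2.
  by rewrite -[leLHS](powRr0 t) ler_powR//; lra.
Qed.

(** No convergence is assumed: if the integral is infinite, [fine] turns both sides into [0]. *)
Lemma GammaD1 {R : realType} (s : R) : 0 < s -> Gamma (s + 1) = s * Gamma s.
Proof.
move=> s0; rewrite /Gamma /Rintegral -/(Gammae (s + 1)) -/(Gammae s) GammaeD1//.
case: (Gammae s) => [r| |] //=.
- by rewrite gt0_muley ?lte_fin// mulr0.
- by rewrite gt0_muleNy ?lte_fin// mulr0.
Qed.

Lemma Gamma1 {R : realType} : Gamma (1 : R) = 1.
Proof. by rewrite /Gamma /Rintegral -/(Gammae 1) Gammae1. Qed.

(** The functional equation moves the argument into [[1, 2]], where the integral is known to be both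
    positive and finite. Finiteness matters because [fine] sends [+oo] to [0]. *)
Lemma Gamma_gt0 {R : realType} (s : R) : 0 < s <= 1 -> 0 < Gamma s.
Proof.
move=> /andP[s0 s1].
have : 0 < Gamma (s + 1).
  by apply: fine_gt0; rewrite Gammae_gt0 ?Gammae_lty//; lra.
by rewrite GammaD1// pmulr_rgt0.
Qed.

Lemma Gamma_ratio {R : realType} (q : R) (T : nat) : 0 < q < 1 ->
  Gamma (1 - q) * Gamma T.+1%:R / Gamma (T.+1%:R - q) =
  \prod_(1 <= t < T.+1) (t%:R / (t%:R - q)).
Proof.
move=> /andP[q0 q1].
have g0 : 0 < Gamma (1 - q) by apply: Gamma_gt0; lra.
(* The induction carries positivity of the denominator along, since each step divides by it. *)
suff [-> G] : Gamma (1 - q) * Gamma T.+1%:R / Gamma (T.+1%:R - q) =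
  \prod_(1 <= t < T.+1) (t%:R / (t%:R - q)) /\ 0 < Gamma (T.+1%:R - q) by [].
elim: T => [|T [IH G]]; first by rewrite big_geq// Gamma1 mulr1 mulfV// gt_eqF.
have T0 : 0 < T.+1%:R - q by rewrite subr_gt0 (lt_le_trans q1)// ler1n.
have E : Gamma (T.+2%:R - q) = (T.+1%:R - q) * Gamma (T.+1%:R - q).
  by rewrite -GammaD1// -[T.+2%:R]natr1 addrAC.
rewrite E pmulr_rgt0//; split => //.
rewrite big_nat_recr//= -IH -[T.+2%:R]natr1 GammaD1//.
move: T0 G; move: (Gamma (T.+1%:R - q)) (T.+1%:R : R) => g x T0 G.
by field; rewrite !gt_eqF.
Qed.

(** * Iterated Gaussian integrals *)

(** Both sides are the joint density of independent centered Gaussians with variances [a] and [b].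
    The right side uses the coordinates [n - c m] and [(b m + c a n) / (c^2 a + b)], which are
    uncorrelated, and the change of variables has determinant [-1]. *)
Lemma gpdf_mul {R : realType} (a b c m n : R) : 0 < a -> 0 < b ->
  gpdf a m * gpdf b n =
  gpdf (c ^+ 2 * a + b) (n - c * m) *
  gpdf (a * b / (c ^+ 2 * a + b)) ((b * m + c * a * n) / (c ^+ 2 * a + b)).
Proof.
move=> a0 b0; have s0 : 0 < c ^+ 2 * a + b.
  by rewrite ltr_wpDl// mulr_ge0 ?sqr_ge0// ltW.
have r0 : 0 < a * b / (c ^+ 2 * a + b) by rewrite divr_gt0// mulr_gt0.
have pn x : 0 < x -> 0 <= x * pi *+ 2.
  by move=> x0; rewrite mulrn_wge0// mulr_ge0 ?pi_ge0// ltW.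
rewrite !gpdfE// mulrACA -expRD [RHS]mulrACA -expRD -!invfM; congr (_^-1 * expR _).
  rewrite -!sqrtrM ?pn//; congr Num.sqrt.
  by field; rewrite gt_eqF.
by field; rewrite !gt_eqF.
Qed.

Lemma intR_gpdfM {R : realType} (v m a : R) : 0 < v ->
  intR (fun u => a * gpdf v (u - m)) = a.
Proof.
move=> v0; transitivity (a + 0 * m + 0 * (m ^+ 2 + v)); last by ring.
by rewrite -intR_gpdf_quadratic//; congr intR; apply/funext => u; ring.
Qed.

(** Chapman-Kolmogorov with a scale: after [gpdf_mul] the first factor is free of [z] and the second
    integrates to [1]. The value [c = 1] serves the walks, [c = q] the normalization of
    posteriors. *)
Lemma intR_gpdf_prod {R : realType} (K a b c m n : R) : 0 < a -> 0 < b ->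
  intR (fun z => K * (gpdf a (m - z) * gpdf b (n - c * z))) =
  K * gpdf (c ^+ 2 * a + b) (n - c * m).
Proof.
move=> a0 b0; have s0 : 0 < c ^+ 2 * a + b.
  by rewrite ltr_wpDl// mulr_ge0 ?sqr_ge0// ltW.
have r0 : 0 < a * b / (c ^+ 2 * a + b) by rewrite divr_gt0// mulr_gt0.
rewrite -[RHS](intR_gpdfM _ ((b * m + c * a * n) / (c ^+ 2 * a + b)) _ r0).
congr intR; apply/funext => z; rewrite (gpdf_mul a b c)// -[RHS]mulrA.
rewrite (_ : n - c * z - c * (m - z) = n - c * m); last by ring.
congr (_ * (_ * _)); rewrite -gpdfN//; congr gpdf.
by field; rewrite gt_eqF.
Qed.

(** The common form of [intX] and [intY] once the other family is frozen; the head of [l] is the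
    outermost integral. *)
Definition int_coords {R : realType} (l : seq nat) (F : (nat -> R) -> R) :
    (nat -> R) -> R :=
  foldr (fun i G z => intR (fun u => G (upd z i u))) F l.

Lemma intXE {R : realType} l (F : (nat -> R) -> (nat -> R) -> R) x y :
  intX l F x y = int_coords l (fun x => F x y) x.
Proof.
elim: l x => //= i l IH x; congr intR.
by apply/funext => u; rewrite -IH.
Qed.

Lemma intYE {R : realType} l (F : (nat -> R) -> (nat -> R) -> R) x y :
  intY l F x y = int_coords l (F x) y.
Proof.
elim: l y => //= i l IH y; congr intR.
by apply/funext => u; rewrite -IH.
Qed.

(** The last coordinate is the innermost integral, so inductions on walks can remove the last step
    first. *)
Lemma int_coords_iota_recr {R : realType} t (F : (nat -> R) -> R) :
  int_coords (iota 1 t.+1) F =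
  int_coords (iota 1 t) (fun z => intR (fun u => F (upd z t.+1 u))).
Proof.
have -> : iota 1 t.+1 = iota 1 t ++ [:: t.+1] by rewrite -[in LHS](addn1 t) iotaD.
by rewrite /int_coords foldr_cat.
Qed.

(** Under the integrals, the coordinates outside [l], that is the observed signals, keep their
    values. *)
Lemma eq_int_coords {R : realType} l (F G : (nat -> R) -> R) z :
  (forall z', (forall i, i \notin l -> z' i = z i) -> F z' = G z') ->
  int_coords l F z = int_coords l G z.
Proof.
elim: l z => [|i l IH] z FG /=; first exact: FG.
congr intR; apply/funext => u; apply: IH => z' z'E; apply: FG => j.
by rewrite inE negb_or => /andP[/negbTE ji jl]; rewrite z'E// /upd ji.
Qed.

(** The shift [s] is held fixed while [z] is integrated: [s = 0] gives the walk [X], and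
    [s = (1 - q) X] applied to [Y] gives [U]. *)
Definition pos {R : realType} (z0 : R) (s z : nat -> R) (k : nat) : R :=
  at0 z0 z k - s k.

(** Step [k] goes from index [k - 1] to [k], so the product also involves the position at
    [m - 1]. *)
Definition walk {R : realType} (v z0 : R) (s z : nat -> R) (m n : nat) : R :=
  \prod_(m <= k < n) gpdf v (pos z0 s z k - pos z0 s z k.-1).

Lemma pos_upd {R : realType} (z0 : R) s z i u k : (k < i)%N ->
  pos z0 s (upd z i u) k = pos z0 s z k.
Proof. by move=> ki; rewrite /pos /at0 /upd (ltn_eqF ki). Qed.

Lemma pos_updS {R : realType} (z0 : R) s z i u :
  pos z0 s (upd z i.+1 u) i.+1 = u - s i.+1.
Proof. by rewrite /pos /at0 /upd /= eqxx. Qed.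

Lemma walk_gt0 {R : realType} (v z0 : R) s z m n : 0 < v ->
  0 < walk v z0 s z m n.
Proof. by move=> v0; apply: prodr_gt0 => k _; exact: gpdf_gt0. Qed.

Lemma walk_upd {R : realType} (v z0 : R) s z i u m n : (n <= i)%N ->
  walk v z0 s (upd z i u) m n = walk v z0 s z m n.
Proof.
move=> ni; apply: eq_big_nat => k /andP[_ kn].
have ki : (k < i)%N := leq_trans kn ni.
by rewrite !pos_upd// (leq_ltn_trans (leq_pred _)).
Qed.

Lemma walk_mass {R : realType} (v C z0 : R) s z t : 0 < v ->
  int_coords (iota 1 t) (fun z => C * walk v z0 s z 1 t.+1) z = C.
Proof.
move=> v0; elim: t => [|t IH]; first by rewrite /= /walk big_geq// mulr1.
rewrite int_coords_iota_recr -[RHS]IH; congr int_coords; apply/funext => z'.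
rewrite -(intR_gpdfM v (s t.+1 + pos z0 s z' t) (C * walk v z0 s z' 1 t.+1))//.
congr intR; apply/funext => u.
rewrite {1}/walk big_nat_recr//= -/(walk _ _ _ _ _ _) walk_upd//.
by rewrite pos_updS pos_upd// -addrA -opprD mulrA.
Qed.

(** Integrating out the last position merges its step variance into [w]; the induction is therefore
    general in [w], and [t] steps add [v t]. *)
Lemma walk_bridge {R : realType} (v w r C z0 : R) s z t : 0 < v -> 0 < w ->
  int_coords (iota 1 t)
    (fun z => C * (walk v z0 s z 1 t.+1 * gpdf w (r - pos z0 s z t))) z =
  C * gpdf (v * t%:R + w) (r - (z0 - s 0%N)).
Proof.
move=> v0; elim: t w => [|t IH] w w0.
  by rewrite /= /walk big_geq// mul1r mulr0 add0r.
have vw0 : 0 < v + w by exact: addr_gt0.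
rewrite int_coords_iota_recr -natr1 mulrDr mulr1 -addrA -IH//.
congr int_coords; apply/funext => z'.
have := intR_gpdf_prod (C * walk v z0 s z' 1 t.+1) v w 1
  (s t.+1 + pos z0 s z' t) (r + s t.+1) v0 w0.
rewrite expr1n mul1r.
rewrite (_ : r + s t.+1 - 1 * _ = r - pos z0 s z' t); last by ring.
rewrite -mulrA => <-.
congr intR; apply/funext => u.
rewrite {1}/walk big_nat_recr//= -/(walk _ _ _ _ _ _) walk_upd//.
rewrite pos_updS pos_upd// -!mulrA; congr (_ * (_ * _)).
by rewrite -gpdfN//; congr (gpdf _ _ * gpdf _ _); ring.
Qed.

(** The position at [t] has mean [z0 - s 0] and variance [v t]. *)
Lemma walk_quadratic {R : realType} (v C z0 : R) s z T (a b c : nat -> R) :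
  0 < v ->
  int_coords (iota 1 T) (fun z => C * walk v z0 s z 1 T.+1 *
    \sum_(0 <= t < T.+1)
      (a t + b t * pos z0 s z t + c t * pos z0 s z t ^+ 2)) z =
  C * \sum_(0 <= t < T.+1)
    (a t + b t * (z0 - s 0%N) + c t * ((z0 - s 0%N) ^+ 2 + v * t%:R)).
Proof.
move=> v0; elim: T a b c => [|T IH] a b c.
  by rewrite /= /walk big_geq// !big_nat1 !mulr1 mulr0 addr0.
(* Given the position at [T], the last one has the same mean and an extra variance [v]. Integrating
   it out thus adds its coefficients to those at [T]; [e] performs this update. *)
pose e (f : nat -> R) x t := if t == T then f T + x else f t.
transitivity (C * \sum_(0 <= t < T.+1)
    (e a (a T.+1 + c T.+1 * v) t + e b (b T.+1) t * (z0 - s 0%N) +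
     e c (c T.+1) t * ((z0 - s 0%N) ^+ 2 + v * t%:R))); last first.
  congr (_ * _); rewrite !big_nat_recr//= /e eqxx -!addrA; congr (_ + _).
    by apply: eq_big_nat => t tT; rewrite ltn_eqF//; case/andP: tT.
  by rewrite -natr1; ring.
rewrite -IH int_coords_iota_recr; congr int_coords; apply/funext => z'.
set W := walk v z0 s z' 1 T.+1; set p := pos z0 s z' T.
pose S := \sum_(0 <= t < T) (a t + b t * pos z0 s z' t + c t * pos z0 s z' t ^+ 2).
have -> : \sum_(0 <= t < T.+1)
    (e a (a T.+1 + c T.+1 * v) t + e b (b T.+1) t * pos z0 s z' t +
     e c (c T.+1) t * pos z0 s z' t ^+ 2) =
  S + (a T + b T * p + c T * p ^+ 2) + (a T.+1 + b T.+1 * p + c T.+1 * (p ^+ 2 + v)).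
  rewrite big_nat_recr//= /e eqxx -!addrA; congr (_ + _); last by rewrite /p; ring.
  by apply: eq_big_nat => t tT; rewrite ltn_eqF//; case/andP: tT.
have := intR_gpdf_quadratic v (s T.+1 + p)
  (C * W * (S + (a T + b T * p + c T * p ^+ 2) + a T.+1 - b T.+1 * s T.+1 +
    c T.+1 * s T.+1 ^+ 2))
  (C * W * (b T.+1 - c T.+1 * s T.+1 *+ 2)) (C * W * c T.+1) v0.
set lhs := intR _; set rhs := (X in _ = X -> _) => E.
transitivity rhs; last by rewrite /rhs; ring.
rewrite -E /lhs; congr intR; apply/funext => u.
rewrite {1}/walk big_nat_recr//= -/(walk _ _ _ _ _ _) walk_upd// -/W.
rewrite big_nat_recr//= big_nat_recr//= pos_updS pos_upd// -/p.
rewrite (_ : \sum_(0 <= t < T) _ = S); last first.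
  by apply: eq_big_nat => t /andP[_ tT]; rewrite pos_upd// (ltn_trans tT).
rewrite (_ : u - s T.+1 - p = u - (s T.+1 + p)); [ring|by ring].
Qed.

(** * Asymptotics of the logarithmic sum *)

Definition log_sum {R : realType} (q : R) (T : nat) : R :=
  \sum_(1 <= t < T.+1) ln (t%:R / (t%:R - q)).

(** By [ln (1 + u) <= u], both quantities compared lie between [q / (t + 1)] and [q / t]. *)
Lemma log_sum_step {R : realType} (q t : R) : 0 < q < 1 -> 1 <= t ->
  `|ln ((t + 1) / (t + 1 - q)) - q * (ln (t + 1) - ln t)| <=
  q * (t^-1 - (t + 1)^-1).
Proof.
move=> /andP[q0 q1] t1; have t0 : 0 < t by lra.
have tq0 : 0 < t + 1 - q by lra.
have A1 : ln ((t + 1) / (t + 1 - q)) <= q / t.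
  have -> : (t + 1) / (t + 1 - q) = 1 + q / (t + 1 - q).
    by field; rewrite gt_eqF.
  rewrite (le_trans (le_ln1Dx _))//.
    by rewrite (@lt_trans _ _ 0)// ?divr_gt0//; lra.
  by rewrite ler_pM2l// lef_pV2 ?posrE//; lra.
have A2 : q / (t + 1) <= ln ((t + 1) / (t + 1 - q)).
  rewrite -[leRHS]opprK -lnV ?posrE ?divr_gt0//; last by lra.
  have -> : ((t + 1) / (t + 1 - q))^-1 = 1 + - (q / (t + 1)).
    by field; rewrite !gt_eqF//; lra.
  rewrite lerNr le_ln1Dx// ltrN2 ltr_pdivrMr; lra.
have B1 : ln (t + 1) - ln t <= t^-1.
  rewrite -ln_div ?posrE//; last by lra.
  have -> : (t + 1) / t = 1 + t^-1 by field; rewrite gt_eqF.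
  by rewrite le_ln1Dx// (@lt_trans _ _ 0)// ?invr_gt0//; lra.
have B2 : (t + 1)^-1 <= ln (t + 1) - ln t.
  rewrite -[leRHS]opprB -ln_div ?posrE//; last by lra.
  have -> : t / (t + 1) = 1 + - (t + 1)^-1 by field; rewrite gt_eqF//; lra.
  by rewrite lerNr le_ln1Dx// ltrN2 invf_lt1; lra.
have B1q := ler_wpM2l (ltW q0) B1.
have B2q := ler_wpM2l (ltW q0) B2.
rewrite ler_norml mulrBr; apply/andP; split; lra.
Qed.

Lemma log_sum_bound {R : realType} (q : R) (T : nat) : 0 < q < 1 ->
  `|log_sum q T.+1 - q * ln T.+1%:R| <= `|ln (1 - q)^-1| + q.
Proof.
move=> q01; have /andP[q0 q1] := q01.
(* The step bounds telescope to [q (1 - 1 / (T + 1))]; the other summand is the term [t = 1] of the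
   sum. *)
suff h : `|log_sum q T.+1 - q * ln T.+1%:R| <=
    `|ln (1 - q)^-1| + q * (1 - T.+1%:R^-1).
  by rewrite (le_trans h)// lerD2l ler_piMr ?(ltW q0)// gerBl.
elim: T => [|T IH].
  by rewrite /log_sum big_nat1 ln1 mulr0 subr0 invr1 subrr mulr0 addr0 mul1r.
rewrite /log_sum big_nat_recr//= -/(log_sum q T.+1) -[T.+2%:R]natr1.
have T1 : 1 <= T.+1%:R :> R by rewrite ler1n.
have := log_sum_step q T.+1%:R q01 T1.
move: IH T1; move: (T.+1%:R : R) => t IH t1 step.
have -> : log_sum q T.+1 + ln ((t + 1) / (t + 1 - q)) - q * ln (t + 1) =
  (log_sum q T.+1 - q * ln t) +
  (ln ((t + 1) / (t + 1 - q)) - q * (ln (t + 1) - ln t)) by ring.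
rewrite (le_trans (ler_normD _ _))// (le_trans (lerD IH step))//.
by rewrite le_eqVlt; apply/orP; left; apply/eqP; ring.
Qed.

Lemma cvgn_ln_pinfty {R : realType} : (ln n%:R : R) @[n --> \oo] --> +oo.
Proof.
apply/cvgryPge => A; near=> n.
rewrite -[leLHS]expRK ler_ln ?posrE ?expR_gt0//.
  by near: n; exact: nbhs_infty_ger.
by near: n; exact: nbhs_infty_gtr.
Unshelve. all: by end_near. Qed.

Lemma log_sum_bigO {R : realType} (q : R) : 0 < q < 1 -> exists C : R,
  \forall T \near \oo, `|2^-1 * log_sum q T| <= C * ln T%:R.
Proof.
move=> q01; have /andP[q0 q1] := q01.
pose M := `|ln (1 - q)^-1| + q.
have M0 : 0 <= M by rewrite addr_ge0// ltW.
(* Once [ln T >= 1], the bounded error [M] is at most [M ln T]. *)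
exists (q + M); near=> T.
have l1 : 1 <= ln (T%:R : R).
  by near: T; move/cvgryPge: (@cvgn_ln_pinfty R); exact.
have T0 : (0 < T)%N by near: T; exact: nbhs_infty_gt.
have := log_sum_bound q T.-1 q01; rewrite prednK// -/M => h.
rewrite normrM ger0_norm// (@le_trans _ _ `|log_sum q T|)//.
  by rewrite ler_piMl// invf_le1// ler1n.
rewrite -[log_sum q T](subrK (q * ln T%:R)).
rewrite (le_trans (ler_normD _ _))// mulrDl addrC.
rewrite ger0_norm ?mulr_ge0 ?(ltW q0)// ?(le_trans _ l1)//.
by rewrite lerD2l (le_trans h)// ler_peMr.
Unshelve. all: by end_near. Qed.

(** The sum and the denominator differ by at most the constant [M], while the denominator
    diverges. *)
Lemma log_sum_asymptotics {R : realType} (q G : R) : 0 < q < 1 ->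
  (fun T => 2^-1 * log_sum q T / (q * ln T%:R + G)) @ \oo --> (2^-1 : R).
Proof.
move=> q01; have /andP[q0 q1] := q01.
pose M := `|ln (1 - q)^-1| + q + `|G|.
have M0 : 0 <= M by rewrite !addr_ge0// ltW.
have dy : q * ln T%:R + G @[T --> \oo] --> +oo.
  apply/cvgryPge => A; near=> T.
  rewrite -lerBlDr -ler_pdivrMl//.
  by near: T; move/cvgryPge: (@cvgn_ln_pinfty R); exact.
apply/cvgrPdist_le => e e0; near=> T.
have d0 : M / e < q * ln T%:R + G.
  by near: T; move/cvgryPgt: dy; exact.
have d1 : 0 < q * ln (T%:R : R) + G by rewrite (le_lt_trans _ d0)// divr_ge0// ltW.
have T0 : (0 < T)%N by near: T; exact: nbhs_infty_gt.
have := log_sum_bound q T.-1 q01; rewrite prednK// => h.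
rewrite -[X in `|X - _|](mulfK (lt0r_neq0 d1)) -mulrBl normrM normfV.
rewrite (gtr0_norm d1) ler_pdivrMr// -mulrBr normrM ger0_norm//.
rewrite (@le_trans _ _ `|q * ln T%:R + G - log_sum q T|)//.
  by rewrite ler_piMl// invf_le1// ler1n.
rewrite (@le_trans _ _ M)//; last by rewrite mulrC -ler_pdivrMr// ltW.
rewrite addrAC (le_trans (ler_normD _ _))// /M lerD2r distrC//.
Unshelve. all: by end_near. Qed.

(** * Likelihoods *)

Lemma eq_walk {R : realType} (v z0 z0' : R) s s' z z' m n :
  (forall k, (m <= k.+1)%N -> (k < n)%N -> pos z0 s z k = pos z0' s' z' k) ->
  walk v z0 s z m n = walk v z0' s' z' m n.
Proof.
move=> E; apply: eq_big_nat => k /andP[mk kn].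
rewrite !E ?(leq_ltn_trans (leq_pred _) kn) ?(leq_trans mk)//.
exact: leqSpred.
Qed.

Lemma walk_split {R : realType} (v z0 : R) s z t T : (t < T)%N ->
  walk v z0 s z 1 T.+1 = walk v z0 s z 1 t.+1 *
    gpdf v (pos z0 s z t.+1 - pos z0 s z t) * walk v z0 s z t.+2 T.+1.
Proof.
move=> tT; rewrite /walk (@big_cat_nat _ _ _ t.+1)//= ?ltnS 1?ltnW//.
by rewrite -mulrA; congr (_ * _); rewrite big_ltn.
Qed.

Lemma notin_iota1 t i : (t < i)%N -> i \notin iota 1 t.
Proof. by move=> ti; rewrite mem_iota add1n ltnS (leqNgt i) ti andbF. Qed.

(** Step [t + 1] ends at an observed position and plays the exit density of [walk_bridge] with
    [w = v]. The later steps and [C] involve only observed coordinates and come out of the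
    integral. *)
Lemma walk_bridge_tail {R : realType} (v z0 : R) s z t T
    (C : (nat -> R) -> R) : 0 < v -> (t < T)%N ->
  (forall z', (forall i, (t < i)%N -> z' i = z i) -> C z' = C z) ->
  int_coords (iota 1 t) (fun z => C z * walk v z0 s z 1 T.+1) z =
  C z * walk v z0 s z t.+2 T.+1 *
    gpdf (v * t.+1%:R) (pos z0 s z t.+1 - (z0 - s 0%N)).
Proof.
move=> v0 tT CE; rewrite -natr1 mulrDr mulr1 -(walk_bridge v v _ _ _ s z)//.
apply: eq_int_coords => z' z'E.
have {}z'E i : (t < i)%N -> z' i = z i by move=> ti; rewrite z'E// notin_iota1.
have pE i : (t < i)%N -> pos z0 s z' i = pos z0 s z i.
  by case: i => // i ti; rewrite /pos /at0 /= z'E.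
rewrite (walk_split _ _ _ _ t)// CE// pE//.
rewrite (eq_walk _ _ z0 _ s _ z t.+2); last by move=> k tk _; rewrite pE.
by ring.
Qed.

(** Subtracted from [Y], it yields [U]. At index [0] it equals [(1 - q) z], so [U] starts at
    [q z]. *)
Definition yshift {R : realType} (q z : R) (x : nat -> R) (k : nat) : R :=
  (1 - q) * at0 z x k.

(** At each step, [gpdf_mul] with [c = -1] turns the independent pair [B], [A] into [A + B] and
    [q B - (1 - q) A]. *)
Lemma joint_walk {R : realType} (q z : R) T x y : 0 < q < 1 ->
  joint q T z x y = walk 1 z (fun=> 0) x 1 T.+1 *
    walk (q * (1 - q)) z (yshift q z x) y 1 T.+1.
Proof.
move=> /andP[q0 q1]; rewrite /joint /walk -big_split/=; apply: eq_big_nat => k _.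
rewrite (gpdf_mul (1 - q) q (-1)) ?subr_gt0//.
rewrite (_ : (-1) ^+ 2 * (1 - q) + q = 1) ?divr1; last by ring.
by rewrite /pos /yshift; congr (gpdf _ _ * gpdf _ _); ring.
Qed.

Section likelihood.
Context {R : realType} (q : R) (T : nat) (x y : nat -> R) (q01 : 0 < q < 1).
Let v := q * (1 - q).
Let U k := y k - (1 - q) * x k.

Let v0 : 0 < v.
Proof. by case/andP: q01 => ? ?; rewrite mulr_gt0// subr_gt0. Qed.

(** Only index [0] depends on the outcome, and the tails used below start at step [2] or later, so
    the start [0] is a placeholder. *)
Let tail s t : R := walk 1 0 (fun=> 0) x t T.+1 *
  walk v 0 (fun k => (1 - q) * x k) y s T.+1.

Let tail_gt0 s t : 0 < tail s t.
Proof. by rewrite mulr_gt0// walk_gt0. Qed.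

Let shiftE z x' k t : (forall i, (t < i)%N -> x' i = x i) -> (t < k)%N ->
  yshift q z x' k = (1 - q) * x k.
Proof. by case: k => // k x'E tk; rewrite /yshift /at0/= x'E. Qed.

Let walkE z x' t s : (t < s)%N -> (forall i, (t < i)%N -> x' i = x i) ->
  walk v z (yshift q z x') y s.+1 T.+1 =
  walk v 0 (fun k => (1 - q) * x k) y s.+1 T.+1.
Proof.
move=> ts x'E; apply: eq_walk => k sk _; have tk := leq_trans ts sk.
rewrite /pos (shiftE z x' k t)// /at0.
by case: k {sk} tk.
Qed.

Let shift0 z x' : z - yshift q z x' 0%N = q * z.
Proof. by rewrite /yshift /at0/=; ring. Qed.

(** The first [t + 1] steps of each walk collapse to one Gaussian density; the observed steps beyond
    form [K]. *)
Lemma lik_afterE t : (t < T)%N -> exists2 K, 0 < K & lik_after q T t.+1 x y =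
  (fun z => K * (gpdf t.+1%:R (x t.+1 - z) *
                 gpdf (v * t.+1%:R) (U t.+1 - q * z))).
Proof.
move=> tT; exists (tail t.+2 t.+2) => //; apply/funext => z.
rewrite /lik_after intXE.
(* This is what the inner integral over [y] leaves of the walk [U]. It sees [x'] only above index
   [t], hence is constant under the integral over [x]. *)
pose C x' := walk v z (yshift q z x') y t.+2 T.+1 *
  gpdf (v * t.+1%:R) (pos z (yshift q z x') y t.+1 - q * z).
transitivity (int_coords (iota 1 t)
    (fun x' => C x' * walk 1 z (fun=> 0) x' 1 T.+1) x).
  congr int_coords; apply/funext => x'; rewrite intYE.
  transitivity (int_coords (iota 1 t) (fun y' => walk 1 z (fun=> 0) x' 1 T.+1 *
      walk v z (yshift q z x') y' 1 T.+1) y).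
    by congr int_coords; apply/funext => y'; rewrite joint_walk.
  rewrite (walk_bridge_tail _ _ _ _ _ _ (fun=> walk 1 z (fun=> 0) x' 1 T.+1))//.
  by rewrite shift0 /C; ring.
have CE x' : (forall i, (t < i)%N -> x' i = x i) ->
    C x' = walk v 0 (fun k => (1 - q) * x k) y t.+2 T.+1 *
      gpdf (v * t.+1%:R) (U t.+1 - q * z).
  by move=> x'E; rewrite /C (walkE _ _ t)// /pos (shiftE _ _ _ t).
rewrite walk_bridge_tail//; last by move=> x' x'E; rewrite !CE.
rewrite CE// mul1r subr0 /pos subr0 /= /tail.
rewrite (eq_walk _ z 0 _ (fun=> 0) _ x t.+2); last by case.
by ring.
Qed.

(** Here [y] at [t + 1] is still hidden, so the lowest known value of [U] sits one index above that
    of [X]. *)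
Lemma lik_beforeE t : (t.+1 < T)%N ->
  exists2 K, 0 < K & lik_before q T t.+1 x y =
  (fun z => K * (gpdf t.+1%:R (x t.+1 - z) *
                 gpdf (v * t.+2%:R) (U t.+2 - q * z))).
Proof.
move=> tT; exists (tail t.+3 t.+2) => //; apply/funext => z.
rewrite /lik_before intXE.
pose C x' := walk v z (yshift q z x') y t.+3 T.+1 *
  gpdf (v * t.+2%:R) (pos z (yshift q z x') y t.+2 - q * z).
transitivity (int_coords (iota 1 t)
    (fun x' => C x' * walk 1 z (fun=> 0) x' 1 T.+1) x).
  congr int_coords; apply/funext => x'; rewrite intYE.
  transitivity (int_coords (iota 1 t.+1) (fun y' => walk 1 z (fun=> 0) x' 1 T.+1 *
      walk v z (yshift q z x') y' 1 T.+1) y).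
    by congr int_coords; apply/funext => y'; rewrite joint_walk.
  rewrite (walk_bridge_tail _ _ _ _ _ _ (fun=> walk 1 z (fun=> 0) x' 1 T.+1))//.
  by rewrite shift0 /C; ring.
have CE x' : (forall i, (t < i)%N -> x' i = x i) ->
    C x' = walk v 0 (fun k => (1 - q) * x k) y t.+3 T.+1 *
      gpdf (v * t.+2%:R) (U t.+2 - q * z).
  by move=> x'E; rewrite /C (walkE _ _ t)// /pos (shiftE _ _ _ t).
rewrite walk_bridge_tail//; [|exact: ltnW|by move=> x' x'E; rewrite !CE].
rewrite CE// mul1r subr0 /pos subr0 /= /tail.
rewrite (eq_walk _ z 0 _ (fun=> 0) _ x t.+2); last by case.
by ring.
Qed.

(** Before the prediction at time [T] nothing has been announced: the walk [U] integrates to [1] and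
    only [X] informs. *)
Lemma lik_before_lastE t : T = t.+1 ->
  exists2 K, 0 < K & lik_before q T t.+1 x y =
  (fun z => K * gpdf t.+1%:R (x t.+1 - z)).
Proof.
move=> TE; exists 1 => //; apply/funext => z.
rewrite /lik_before intXE.
transitivity (int_coords (iota 1 t)
    (fun x' => 1 * walk 1 z (fun=> 0) x' 1 T.+1) x).
  congr int_coords; apply/funext => x'; rewrite intYE mul1r.
  rewrite -[RHS](walk_mass v _ z (yshift q z x') y T)// TE.
  by congr int_coords; apply/funext => y'; rewrite joint_walk.
rewrite (walk_bridge_tail _ _ _ _ _ _ (fun=> 1)) ?TE//.
by rewrite /walk big_geq// /pos !mul1r !subr0.
Qed.

End likelihood.

(** * Rewards *)

Lemma posterior_prod {R : realType} (K a b c m n w : R) :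
  0 < K -> 0 < a -> 0 < b ->
  posterior (fun z => K * (gpdf a (m - z) * gpdf b (n - c * z))) w =
  gpdf a (m - w) * gpdf b (n - c * w) / gpdf (c ^+ 2 * a + b) (n - c * m).
Proof.
move=> K0 a0 b0; rewrite /posterior intR_gpdf_prod//.
by rewrite -mulf_div divff ?mul1r// gt_eqF.
Qed.

Lemma posterior_gpdf {R : realType} (K a m w : R) : 0 < K -> 0 < a ->
  posterior (fun z => K * gpdf a (m - z)) w = gpdf a (m - w).
Proof.
move=> K0 a0; rewrite /posterior.
have -> : (fun z => K * gpdf a (m - z)) = (fun z => K * gpdf a (z - m)).
  by apply/funext => z; rewrite -gpdfN// opprB.
by rewrite intR_gpdfM// mulrC mulKf ?gt_eqF// -gpdfN// opprB.
Qed.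

Lemma ln_gpdf {R : realType} (s w : R) : 0 < s ->
  ln (gpdf s w) = - (2^-1 * ln (s * pi *+ 2)) - w ^+ 2 / (s *+ 2).
Proof.
move=> s0; have p0 : 0 < s * pi *+ 2 by rewrite pmulrn_lgt0// mulr_gt0 ?pi_gt0.
rewrite gpdfE// lnM ?posrE ?expR_gt0 ?invr_gt0 ?sqrtr_gt0//.
by rewrite lnV ?posrE ?sqrtr_gt0// expRK -powR12_sqrt ?(ltW p0)// ln_powR mulNr.
Qed.

(** The terms [P] cancel except [P 1], which supplies the missing [B 1]. *)
Lemma sum_telescope {R : realType} (P A B : nat -> R) n : P 1%N = B 1%N ->
  \sum_(1 <= t < n.+1) (P t - A t - P t.+1 + B t.+1) + (P n.+1 - A n.+1) =
  \sum_(1 <= t < n.+2) (B t - A t).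
Proof.
move=> PB; elim: n => [|n IH]; first by rewrite big_geq// big_nat1 add0r PB.
rewrite big_nat_recr//= [RHS]big_nat_recr//= -IH; ring.
Qed.

Section reward.
Context {R : realType} (q : R) (T : nat) (x0 : R) (x y : nat -> R)
  (q01 : 0 < q < 1).
Let v := q * (1 - q).
Let U k := y k - (1 - q) * x k.
Let X := at0 x0 x.
(** Centered at [q x0], [U t] has variance [q (1 - q) t]. The normalizing integrals add [q^2 t] or
    [q^2 (t - 1)], giving the variances in [after] and [before]. *)
Let prior t := ln (gpdf (v * t%:R) (U t - q * x0)).
Let after t := ln (gpdf (q * t%:R) (U t - q * X t)).
Let before t := ln (gpdf (q * (t%:R - q)) (U t - q * X t.-1)).

Let v0 : 0 < v.
Proof. by case/andP: q01 => ? ?; rewrite mulr_gt0// subr_gt0. Qed.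

Let ln_ratio (a b c d e : R) : 0 < a -> 0 < b -> 0 < c -> 0 < d -> 0 < e ->
  ln (a * b / c / (a * d / e)) = ln b - ln c - ln d + ln e.
Proof.
move=> a0 b0 c0 d0 e0.
have -> : a * b / c / (a * d / e) = b / c * (e / d).
  by field; rewrite !gt_eqF.
rewrite lnM ?posrE ?divr_gt0// !ln_div ?posrE//; ring.
Qed.

(** The density of [X] given the outcome is common to both posteriors and cancels; the four
    remaining factors are those of [U]. *)
Lemma rewardE t : (t.+1 < T)%N ->
  reward q T t.+1 x0 x y = prior t.+1 - after t.+1 - prior t.+2 + before t.+2.
Proof.
move=> tT; have /andP[q0 q1] := q01; rewrite /reward.
have [K K0 ->] := lik_afterE q T x y q01 t (ltnW tT).
have [L L0 ->] := lik_beforeE q T x y q01 t tT.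
have n0 n : 0 < n.+1%:R :> R by rewrite ltr0n.
have vn n : 0 < q * (1 - q) * n.+1%:R by exact: mulr_gt0.
have sn m n : 0 < q ^+ 2 * m.+1%:R + q * (1 - q) * n.+1%:R.
  by rewrite addr_gt0 ?vn// mulr_gt0// exprn_gt0.
rewrite !posterior_prod; [|exact: L0|exact: n0|exact: vn|exact: K0|exact: n0|exact: vn].
rewrite ln_ratio; [|exact: gpdf_gt0..].
have -> : q ^+ 2 * t.+1%:R + q * (1 - q) * t.+1%:R = q * t.+1%:R by ring.
have -> : q ^+ 2 * t.+1%:R + q * (1 - q) * t.+2%:R = q * (t.+2%:R - q).
  by rewrite -[t.+2%:R]natr1; ring.
by [].
Qed.

Lemma reward_lastE t : T = t.+1 ->
  reward q T t.+1 x0 x y = prior t.+1 - after t.+1.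
Proof.
move=> TE; have /andP[q0 q1] := q01; rewrite /reward.
have tT : (t < T)%N by rewrite TE.
have [K K0 ->] := lik_afterE q T x y q01 t tT.
have [L L0 ->] := lik_before_lastE q T x y q01 t TE.
have n0 n : 0 < n.+1%:R :> R by rewrite ltr0n.
have vn n : 0 < q * (1 - q) * n.+1%:R by exact: mulr_gt0.
have sn m n : 0 < q ^+ 2 * m.+1%:R + q * (1 - q) * n.+1%:R.
  by rewrite addr_gt0 ?vn// mulr_gt0// exprn_gt0.
rewrite posterior_prod; [|exact: K0|exact: n0|exact: vn].
rewrite posterior_gpdf; [|exact: L0|exact: n0].
set g := gpdf t.+1%:R _; have g0 : 0 < g by exact: gpdf_gt0.
have -> (b c : R) : g * b / c / g = b / c.
  by rewrite -[g * b / c]mulrA [g * _]mulrC mulfK ?gt_eqF.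
rewrite ln_div ?posrE; [|exact: gpdf_gt0..].
by have -> : q ^+ 2 * t.+1%:R + q * (1 - q) * t.+1%:R = q * t.+1%:R by ring.
Qed.

Lemma total_rewardE : total_reward q T x0 x y =
  \sum_(1 <= t < T.+1) (before t - after t).
Proof.
have [T0|[n TE]] : T = 0%N \/ exists n, T = n.+1.
- by case: T => [|n]; [left|right; exists n].
- by rewrite /total_reward T0 !big_geq.
transitivity (\sum_(1 <= t < n.+2) reward q T t x0 x y).
  by rewrite /total_reward TE.
rewrite big_nat_recr//= (reward_lastE n)// [in RHS]TE.
transitivity (\sum_(1 <= t < n.+1) (prior t - after t - prior t.+1 + before t.+1)
    + (prior n.+1 - after n.+1)).
  congr (_ + _); apply: eq_big_nat => -[//|t] /andP[_ tn].
  by rewrite rewardE// TE.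
(* At [t = 1], [before] and [prior] agree because [X 0] is [x0] and both variances are
   [q (1 - q)]. *)
apply: sum_telescope; congr (ln (gpdf _ _)).
by rewrite /v mulr1.
Qed.

End reward.

(** * Expected total reward *)

(** Collects the coefficients by time index, the form to which [walk_quadratic] applies. *)
Lemma sum_regroup {R : realType} (a b G : nat -> R) T :
  \sum_(0 <= t < T.+1)
     ((if (t < T)%N then a t.+1 else 0) + (if t == 0%N then 0 else b t)) * G t =
  \sum_(1 <= t < T.+1) (a t * G t.-1 + b t * G t).
Proof.
under eq_bigr do rewrite mulrDl.
rewrite !big_split/=; congr (_ + _).
  rewrite big_nat_recr//= ltnn mul0r addr0 big_add1/=.
  by apply: eq_big_nat => t /andP[_ ->].
rewrite big_ltn//= mul0r add0r.
by apply: eq_big_nat => -[].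
Qed.

Lemma XiE {R : realType} (q x0 : R) T : 0 < q < 1 ->
  Xi q T x0 = 2^-1 * log_sum q T.
Proof.
move=> q01; have /andP[q0 q1] := q01; set v := q * (1 - q).
have v0 : 0 < v by rewrite mulr_gt0// subr_gt0.
pose k t : R := 2^-1 * ln (t%:R / (t%:R - q)).
pose e1 t : R := (q * (t%:R - q) *+ 2)^-1.
pose e2 t : R := (q * t%:R *+ 2)^-1.
(* Given [X], [U t] has mean [q x0] and variance [v t]. Averaging over [Y] thus turns each square
   into [v t] plus [q^2] times a squared displacement of [X] from [x0]. *)
pose al t := - e1 t * q ^+ 2.
pose be t := e2 t * q ^+ 2.
pose ga t := k t + (e2 t - e1 t) * (v * t%:R).
have tq t : (0 < t)%N -> 0 < t%:R - q.
  by move=> t0; rewrite subr_gt0 (lt_le_trans q1)// ler1n.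
have rewE x y : total_reward q T x0 x y = \sum_(1 <= t < T.+1)
    (k t - e1 t * (y t - (1 - q) * x t - q * at0 x0 x t.-1) ^+ 2 +
     e2 t * (y t - (1 - q) * x t - q * at0 x0 x t) ^+ 2).
  rewrite total_rewardE//; apply: eq_big_nat => t /andP[t0 _].
  have := tq t t0; have : 0 < t%:R :> R by rewrite ltr0n.
  rewrite /k /e1 /e2; move: (t%:R : R) => s s0 sq.
  rewrite !ln_gpdf ?mulr_gt0//.
  have pp : 0 < pi *+ 2 :> R by rewrite pmulrn_lgt0// pi_gt0.
  rewrite -!mulrnAr !lnM ?posrE ?mulr_gt0 ?invr_gt0// lnV ?posrE//.
  rewrite (mulrC _ (_^-1)) (mulrC _ (_^-1)); ring.
rewrite /Xi intXE.
pose D x t := (at0 x0 x t - x0) ^+ 2 : R.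
transitivity (int_coords (iota 1 T) (fun x => 1 * walk 1 x0 (fun=> 0) x 1 T.+1 *
    \sum_(1 <= t < T.+1) (ga t + (al t * D x t.-1 + be t * D x t))) (fun=> 0)).
  congr int_coords; apply/funext => x; rewrite intYE mul1r.
  set W := walk 1 _ _ _ _ _.
  (* The sum in [walk_quadratic] starts at [0] while rewards start at [1]; [z] blanks the extra
     term. Then [a], [b], [c] are the coefficients of the reward as a polynomial in [U t]. *)
  pose z t (r : R) := if t == 0%N then 0 else r.
  pose X := at0 x0 x.
  pose c t := z t (e2 t - e1 t).
  pose b t := z t (q *+ 2 * (X t.-1 * e1 t - X t * e2 t)).
  pose a t := z t (k t - e1 t * (q * X t.-1) ^+ 2 + e2 t * (q * X t) ^+ 2).
  have := walk_quadratic v W x0 (yshift q x0 x) (fun=> 0) T a b c v0.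
  rewrite (_ : x0 - yshift q x0 x 0%N = q * x0); last by rewrite /yshift /at0/=; ring.
  rewrite [in X in _ = X -> _]big_ltn//= /a /b /c /z/= !mul0r !addr0 add0r => E.
  transitivity (W * \sum_(1 <= t < T.+1) (a t + b t * (q * x0) +
      c t * ((q * x0) ^+ 2 + v * t%:R))); last first.
    congr (_ * _); apply: eq_big_nat => -[//|t] _.
    by rewrite /a /b /c /z/= /ga /al /be /D -/X; ring.
  rewrite -E; congr int_coords; apply/funext => y.
  rewrite joint_walk// -/W rewE; congr (_ * _).
  rewrite [RHS]big_ltn//= !mul0r !add0r.
  apply: eq_big_nat => -[//|t] _ /=.
  by rewrite /pos /yshift /X /at0 /=; ring.
have dE (f : nat -> R) : \sum_(1 <= t < T.+1)
    (ga t + (al t * f t.-1 + be t * f t)) =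
  \sum_(1 <= t < T.+1) ga t + \sum_(0 <= t < T.+1)
     ((if (t < T)%N then al t.+1 else 0) + (if t == 0%N then 0 else be t)) * f t.
  by rewrite sum_regroup -big_split.
pose S := \sum_(1 <= t < T.+1) ga t.
pose h t := (if (t < T)%N then al t.+1 else 0) + (if t == 0%N then 0 else be t).
(* The constant [S] is charged to index [0] so that it counts once; the rest expands [(X t - x0)^2]
   in powers of [X t]. *)
pose a t := (if t == 0%N then S else 0) + h t * x0 ^+ 2.
have aE (f : nat -> R) : \sum_(0 <= t < T.+1) (a t + f t) =
    S + \sum_(0 <= t < T.+1) (h t * x0 ^+ 2 + f t).
  rewrite big_ltn// [in RHS]big_ltn// /a eqxx -!addrA; congr (_ + (_ + (_ + _))).
  by apply: eq_big_nat => -[//|t] _; rewrite add0r.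
have := walk_quadratic 1 1 x0 (fun=> 0) (fun=> 0) T a
  (fun t => - (h t * x0 *+ 2)) h ltr01.
rewrite subr0 [in X in _ = X -> _]mul1r.
set L := int_coords _ _ _ => E.
transitivity L.
  congr int_coords; apply/funext => x; congr (_ * _).
  under [RHS]eq_bigr do rewrite -addrA.
  rewrite dE aE; congr (_ + _); apply: eq_bigr => t _.
  by rewrite /pos subr0 /D -/(h t); ring.
rewrite E; under eq_bigr do rewrite -addrA.
rewrite aE.
(* The mean of [(X t - x0)^2] is [t]. *)
transitivity (S + \sum_(0 <= t < T.+1) h t * t%:R).
  by congr (_ + _); apply: eq_bigr => t _; ring.
rewrite -[S + _]dE /log_sum mulr_sumr; apply: eq_big_nat => -[//|t] _.
have := tq t.+1 isT; have : 0 < t.+1%:R :> R by rewrite ltr0n.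
rewrite /ga /al /be /k /e1 /e2 /v /=.
rewrite (_ : t%:R = t.+1%:R - 1 :> R); last by rewrite -natr1 addrK.
move: (t.+1%:R : R) => s s0 sq.
(* The quadratic parts total [- e1 q (t - q) + e2 q t], that is [- 1/2 + 1/2]. *)
rewrite -!addrA -[RHS]addr0; congr (_ + _).
by field; rewrite !gt_eqF.
Qed.

Theorem theorem2 (R : realType) (q : R) (hq0 : 0 < q) (hq1 : q < 1) :
  (forall (T : nat) (x0 : R),
      Xi q T x0 = 2^-1 * \sum_(1 <= t < T.+1) ln (t%:R / (t%:R - q))
   /\ Xi q T x0 =
        2^-1 * ln (Gamma (1 - q) * Gamma (T.+1%:R) / Gamma (T.+1%:R - q)))
  /\ (forall x0 : R, exists C : R,
        \forall T \near \oo, `|Xi q T x0| <= C * ln (T%:R : R))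
  /\ (forall x0 : R,
        (fun T : nat => Xi q T x0 / (q * ln (T%:R : R) + ln (Gamma (1 - q))))
          @ \oo --> (2^-1 : R)).
Proof.
have q01 : 0 < q < 1 by rewrite hq0.
split=> [T x0|]; last split=> x0.
- rewrite XiE//; split=> //; rewrite Gamma_ratio//; congr (_ * _).
  rewrite /log_sum.
  elim: T => [|T IH]; first by rewrite !big_geq// ln1.
  rewrite big_nat_recr//= [in RHS]big_nat_recr//= IH lnM// posrE; last first.
    by rewrite divr_gt0// subr_gt0 (lt_le_trans hq1)// ler1n.
  rewrite big_nat; apply: prodr_gt0 => t /andP[t0 _].
  by rewrite divr_gt0 ?ltr0n// subr_gt0 (lt_le_trans hq1)// ler1n.
- have [C CP] := log_sum_bigO q q01; exists C.
  by apply: filterS CP => T; rewrite XiE.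
- have -> : (fun T => Xi q T x0 / (q * ln T%:R + ln (Gamma (1 - q)))) =
      (fun T => 2^-1 * log_sum q T / (q * ln T%:R + ln (Gamma (1 - q)))).
    by apply/funext => T; rewrite XiE.
  exact: log_sum_asymptotics.
Qed.
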